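(* Let $P$ be a partial latin square of order $n$ whose filled cells are exactly those in the upper left $r\times s$ rectangle (for some $r,s\in\{1,\dots,n\}$), except for $t$ cells of this rectangle that are empty, where no column of the rectangle contains more than one of these empty cells. Then $P$ is completable if and only if $P$ satisfies Hall's Condition.
   Context: A partial latin square of order $n$ is an $n\times n$ array in which some cells are filled with symbols from $\{1,\dots,n\}$, no symbol appearing twice in any row or column; it is completable if its empty cells can be filled to give a latin square. A symbol is missing from a row (column) if it does not appear in a filled cell of that row (column). A cell supports a symbol $\sigma$ if it contains $\sigma$, or it is empty and $\sigma$ is missing from both its row and its column. A set of cells is independent if no two lie in the same row or column; an independent set for $\sigma$ is an independent set all of whose cells support $\sigma$. For a set $T$ of cells, $\alpha(\sigma,T)$ is the maximum size of a subset of $T$ that is an independent set for $\sigma$. The Hall Inequality for $T$ is $\sum_{\sigma=1}^n \alpha(\sigma,T)\ge |T|$. $P$ satisfies Hall's Condition if the Hall Inequality holds for every set $T$ of cells of $P$. *)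

(* Defs.v *)
From mathcomp Require Import all_boot all_algebra.
Set Implicit Arguments.
Unset Strict Implicit.
Unset Printing Implicit Defensive.

(* Rows, columns and symbols {1, ..., n} are encoded 0-based by 'I_n, a cell
   is the pair (row, column), and None marks an empty cell. *)

Definition cell (n : nat) : finType := ('I_n * 'I_n)%type.

Definition parray (n : nat) := 'M[option 'I_n]_n.

Definition filled n (P : parray n) : {set cell n} :=
  [set c : cell n | P c.1 c.2 != None].

Definition partial_latin_square n (P : parray n) : Prop :=
  (forall i j j' k, P i j = Some k -> P i j' = Some k -> j = j') /\
  (forall i i' j k, P i j = Some k -> P i' j = Some k -> i = i').

Definition latin_square n (L : 'M['I_n]_n) : Prop :=
  (forall i, injective (fun j => L i j)) /\
  (forall j, injective (fun i => L i j)).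

Definition completable n (P : parray n) : Prop :=
  exists2 L : 'M['I_n]_n,
    latin_square L & forall i j k, P i j = Some k -> L i j = k.

Definition missing_row n (P : parray n) (k i : 'I_n) : bool :=
  [forall j, P i j != Some k].

Definition missing_col n (P : parray n) (k j : 'I_n) : bool :=
  [forall i, P i j != Some k].

Definition supports n (P : parray n) (k : 'I_n) (c : cell n) : bool :=
  (P c.1 c.2 == Some k) ||
  [&& P c.1 c.2 == None, missing_row P k c.1 & missing_col P k c.2].

Definition independent n (S : {set cell n}) : bool :=
  [forall c in S, forall d in S,
    (c != d) ==> (c.1 != d.1) && (c.2 != d.2)].

Definition independent_for n (P : parray n) (k : 'I_n) (S : {set cell n}) :
    bool :=
  independent S && [forall c in S, supports P k c].

Definition alpha n (P : parray n) (k : 'I_n) (T : {set cell n}) : nat :=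
  \max_(S : {set cell n} | (S \subset T) && independent_for P k S) #|S|.

Definition hall_inequality n (P : parray n) (T : {set cell n}) : Prop :=
  #|T| <= \sum_(k < n) alpha P k T.

Definition hall_condition n (P : parray n) : Prop :=
  forall T : {set cell n}, hall_inequality P T.

Definition upper_left n (r s : nat) : {set cell n} :=
  [set c : cell n | (c.1 < r) && (c.2 < s)].

(* Main.v *)
(* Let m(k) be the number of rows of the r x s rectangle R missing the symbol k.
   By Ryser's theorem (deduced from Koenig's edge colouring theorem) it suffices
   to fill the set E of empty cells of R so that each k is placed in at least
   d(k) = max(0, m(k) - (n - s)) of them.  As E has at most one cell in each
   column, the only conflicts are within rows, and a filling is a matching
   between E and the pairs (row, symbol).  Hall's inequality for the subsets of E
   gives a matching covering E.  Hall's inequality for the sets ~: (E :&: X),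
   with alpha k (~: (E :&: X)) <= n - (d(k) - alpha k (E :\: X)), is the cut
   condition for a matching that meets all the demands d(k).  A
   Mendelsohn-Dulmage argument merges the two matchings. *)
Require Import Defs.
From mathcomp Require Import all_boot all_algebra.
From mathcomp Require Import zify.
Set Implicit Arguments.
Unset Strict Implicit.
Unset Printing Implicit Defensive.

(** * Hall's theorem and the Mendelsohn-Dulmage theorem for bipartite graphs *)

Section Matchings.
Variables A B : finType.
Implicit Types (G M : {set A * B}) (S X : {set A}).

Definition matching M : Prop := {in M &, injective fst} /\ {in M &, injective snd}.

Definition nbr G S : {set B} := [set b | [exists a in S, (a, b) \in G]].

Lemma nbrP G S b : reflect (exists2 a, a \in S & (a, b) \in G) (b \in nbr G S).
Proof. by rewrite inE; apply: (iffP exists_inP). Qed.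

Lemma matching_sub M M' : M' \subset M -> matching M -> matching M'.
Proof.
move=> /subsetP sM [m1 m2].
by split=> p q /sM pM /sM qM; [apply: m1 | apply: m2].
Qed.

(* Rado's argument: in an edge-minimal graph satisfying the hypothesis no vertex
   of [X] has two edges, for otherwise the sets blocking the removal of each of
   them would contradict submodularity of the neighbourhood size. *)
Lemma hall G X :
  (forall S, S \subset X -> #|S| <= #|nbr G S|) ->
  exists M, [/\ M \subset G, matching M & X \subset fst @: M].
Proof.
have [m] := ubnP #|G|; elim: m G => // m IH G ltGm hallG.
have [/existsP[a /existsP[b1 /existsP[b2 /and4P[aX ab1 ab2 b12]]]] | nodup] :=
  boolP [exists a, exists b1, exists b2,
    [&& a \in X, (a, b1) \in G, (a, b2) \in G & b1 != b2]].
  have rm b : (a, b) \in G ->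
      (exists M, [/\ M \subset G, matching M & X \subset fst @: M]) \/
      exists S, [/\ S \subset X, a \in S & #|nbr (G :\ (a, b)) S| < #|S|].
    move=> abG.
    have [/existsP[S /andP[SX ltS]]|ok] :=
      boolP [exists S : {set A}, (S \subset X) && (#|nbr (G :\ (a, b)) S| < #|S|)].
      right; exists S; split=> //; apply: contraTT ltS => aS.
      rewrite -leqNgt (leq_trans (hallG _ SX)) // subset_leq_card //.
      apply/subsetP=> c /nbrP[a' a'S a'c]; apply/nbrP; exists a' => //.
      rewrite !inE a'c andbT; apply: contraNneq aS => -[<- _] //.
    left; have [||M [MG mM XM]] := IH (G :\ (a, b)).
    - by move: ltGm; rewrite (cardsD1 (a, b) G) abG.
    - move=> S SX; rewrite leqNgt; apply: contraNN ok => ltS.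
      by apply/existsP; exists S; rewrite SX.
    by exists M; split=> //; apply: subset_trans MG (subD1set _ _).
  case: (rm _ ab1) => // -[S1 [S1X aS1 lt1]].
  case: (rm _ ab2) => // -[S2 [S2X aS2 lt2]].
  (* The blocking sets give [#|N1| + #|N2| <= #|S1| + #|S2| - 2]. Each edge at [a] survives in one
     of the two reduced graphs, so [N1 :|: N2] covers the neighbours of the union. Dropping [a] from
     the intersection avoids both removed edges and costs only 1, so Hall's inequalities give at
     least [#|S1| + #|S2| - 1]. *)
  exfalso; set N1 := nbr _ S1 in lt1; set N2 := nbr _ S2 in lt2.
  have sU : nbr G (S1 :|: S2) \subset N1 :|: N2.
    apply/subsetP=> c /nbrP[a' a'S a'c]; rewrite inE.
    move: a'S; rewrite inE => a'S; apply/orP; have [eqa|neqa] := eqVneq a' a.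
      have [eqc|neqc] := eqVneq c b1; [right|left]; apply/nbrP; exists a => //.
        by rewrite !inE xpair_eqE eqxx eqc (negPf b12) -eqc -eqa.
      by rewrite !inE xpair_eqE eqxx (negPf neqc) -eqa.
    by case/orP: a'S => a'S; [left|right]; apply/nbrP; exists a';
       rewrite // !inE xpair_eqE (negPf neqa).
  have sI : nbr G (S1 :&: S2 :\ a) \subset N1 :&: N2.
    apply/subsetP=> c /nbrP[a' ]; rewrite in_setD1 => /andP[na /setIP[a1 a2]] a'c.
    apply/setIP; split; apply/nbrP; exists a' => //;
      by rewrite !inE xpair_eqE (negPf na).
  have h1 := hallG (S1 :|: S2); have h2 := hallG (S1 :&: S2 :\ a).
  have {}h1 : #|S1 :|: S2| <= #|N1 :|: N2|.
    by apply: leq_trans (h1 _) (subset_leq_card sU); rewrite subUset S1X.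
  have {}h2 : #|S1 :&: S2 :\ a| <= #|N1 :&: N2|.
    apply: leq_trans (h2 _) (subset_leq_card sI).
    by apply: subset_trans (subD1set _ _) (subset_trans (subsetIl _ _) S1X).
  have h3 : a \in S1 :&: S2 by rewrite inE aS1.
  have := cardsUI S1 S2; have := cardsUI N1 N2.
  rewrite (cardsD1 a (S1 :&: S2)) h3 /=; lia.
have unique a b1 b2 : a \in X -> (a, b1) \in G -> (a, b2) \in G -> b1 = b2.
  move=> aX ab1 ab2; apply: contraNeq nodup => b12.
  by apply/existsP; exists a; apply/existsP; exists b1; apply/existsP; exists b2;
     rewrite aX ab1 ab2.
have cover a : a \in X -> exists b, (a, b) \in G.
  move=> aX; have := hallG [set a]; rewrite sub1set cards1 => /(_ aX).
  by case/card_gt0P=> b /nbrP[a' /set1P->]; exists b.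
(* With one edge at each vertex of [X], the edges at [X] already form a matching: two vertices with
   a common partner would violate Hall's inequality for that pair. *)
exists [set p in G | p.1 \in X]; split.
- by apply/subsetP=> p; rewrite inE => /andP[].
- split=> -[a1 b1] [a2 b2]; rewrite !inE /= => /andP[g1 x1] /andP[g2 x2].
    by move=> eqa; move: g1; rewrite eqa => g1; rewrite (unique _ _ _ x2 g1 g2).
  move=> eqb; move: g1; rewrite eqb => g1; congr (_, _).
  apply/eqP; apply: contraT => na.
  have := hallG [set a1; a2]; rewrite subUset !sub1set x1 x2 cards2 na.
  move/(_ isT); suff -> : nbr G [set a1; a2] = [set b2] by rewrite cards1.
  apply/setP=> b; apply/nbrP/set1P => [[a]|->].
    by rewrite !inE => /orP[]/eqP-> /unique; [apply|apply].
  by exists a1; rewrite ?inE ?eqxx.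
- apply/subsetP=> a aX; have [b ab] := cover _ aX.
  by apply/imsetP; exists (a, b); rewrite ?inE ?ab.
Qed.

(* A Schroeder-Bernstein argument: follow [M1] on a fixed point [C] of the
   alternating-path operator and [M2] elsewhere. *)
Lemma mendelsohn_dulmage M1 M2 : matching M1 -> matching M2 ->
  exists M, [/\ M \subset M1 :|: M2, matching M,
    fst @: M1 \subset fst @: M & snd @: M2 \subset snd @: M].
Proof.
move=> [m1l m1r] [m2l m2r].
(* [F C] holds the vertices covered by [M1] only and those reached from [C] by an [M1] edge followed
   by a reversed [M2] edge. Closure under this step keeps an [M1] edge from [C] and an [M2] edge
   from outside [C] from sharing a right end. *)
pose F (C : {set A}) := (fst @: M1 :\: fst @: M2) :|:
  [set a | [exists b, [exists c in C, ((a, b) \in M2) && ((c, b) \in M1)]]].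
have Fmono : {homo F : C D / C \subset D}.
  move=> C D /subsetP sCD; apply: setUS; apply/subsetP=> a; rewrite !inE.
  case/existsP=> b /exists_inP[c cC h]; apply/existsP; exists b.
  by apply/exists_inP; exists c; rewrite ?sCD.
pose C := fixset F; have CE : F C = C by apply: fixsetK.
have alt a b c : c \in C -> (a, b) \in M2 -> (c, b) \in M1 -> a \in C.
  move=> cC ab cb; rewrite -CE !inE; apply/orP; right; apply/existsP; exists b.
  by apply/exists_inP; exists c; rewrite ?ab.
exists ([set p in M1 | p.1 \in C] :|: [set p in M2 | p.1 \notin C]); split.
- by apply: setUSS; apply/subsetP=> p; rewrite inE => /andP[].
- split=> -[a b] [a' b']; rewrite !inE /=.
    move=> h h' eqa; move: h h'; rewrite -{}eqa.
    move=> /orP[]/andP[h aC] /orP[]/andP[h' aC'].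
    + exact: (m1l _ _ h h' erefl).
    + by rewrite aC in aC'.
    + by rewrite aC' in aC.
    + exact: (m2l _ _ h h' erefl).
  move=> h h' eqb; move: h h'; rewrite -{}eqb.
  move=> /orP[]/andP[h aC] /orP[]/andP[h' aC'].
  + exact: (m1r _ _ h h' erefl).
  + by rewrite (alt _ _ _ aC h' h) in aC'.
  + by rewrite (alt _ _ _ aC' h h') in aC.
  + exact: (m2r _ _ h h' erefl).
- apply/subsetP=> a aM1; have [aC|aC] := boolP (a \in C).
    case/imsetP: aM1 aC => p pM1 ->{a} aC.
    by apply/imsetP; exists p; rewrite // !inE pM1 aC.
  have: a \in fst @: M2 by apply: contraNT aC; rewrite -CE !inE aM1 => ->.
  case/imsetP=> p pM2 eqa; apply/imsetP; exists p => //.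
  by rewrite !inE pM2 -eqa aC orbT.
- apply/subsetP=> _ /imsetP[[a b] abM2 ->] /=.
  have [aC|aC] := boolP (a \in C); last first.
    by apply/imsetP; exists (a, b); rewrite // !inE abM2 aC orbT.
  (* A vertex of [C] covered by [M2] entered [C] by an alternating step, so its [M2] partner is also
     the end of an [M1] edge starting in [C]. *)
  have: a \in F C by rewrite CE.
  rewrite !inE => /orP[/andP[/imsetP[]]|]; first by exists (a, b).
  case/existsP=> b' /exists_inP[c cC /andP[ab' cb']].
  have [eqb] : (a, b) = (a, b') by apply: m2l.
  apply/imsetP; exists (c, b); last by [].
  by rewrite eqb !inE cb' /= cC.
Qed.

Lemma card_edges G S :
  #|[set p in G | p.1 \in S]| = \sum_(a in S) #|[set b | (a, b) \in G]|.
Proof.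
rewrite -sum1_card; under [RHS]eq_bigr do rewrite -sum1_card.
by rewrite pair_big_dep; apply: eq_bigl => -[a b]; rewrite !inE andbC.
Qed.

End Matchings.

(** * Koenig's edge colouring theorem, and matchings with demands *)

Section Transpose.
Variables A B : finType.

Definition swap (p : A * B) := (p.2, p.1).

Lemma mem_swap (G : {set A * B}) a b : ((b, a) \in swap @: G) = ((a, b) \in G).
Proof.
apply/imsetP/idP => [[[a' b'] ? [-> ->]] //|abG]; by exists (a, b).
Qed.

Lemma matching_swap (M : {set A * B}) : matching M -> matching (swap @: M).
Proof.
move=> [ml mr]; split=> -[b a] [b' a']; rewrite !mem_swap /= => h h' e.
  by have [-> ->] := mr _ _ h h' e.
by have [-> ->] := ml _ _ h h' e.
Qed.

End Transpose.

Arguments swap {A B} p.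

Lemma swapK (A B : finType) : cancel (@swap A B) swap.
Proof. by case. Qed.

Lemma swap_swap (A B : finType) (G : {set A * B}) : swap @: (swap @: G) = G.
Proof. by apply/setP=> -[a b]; rewrite !mem_swap. Qed.

(** Double counting verifies Hall's inequality: a set [S] of vertices of degree [k.+1] sends out
    [#|S| * k.+1] edges, and each neighbour absorbs at most [k.+1] of them. *)
Lemma matching_heavy (A B : finType) (G : {set A * B}) (k : nat) :
  (forall b, #|[set a | (a, b) \in G]| <= k.+1) ->
  exists M : {set A * B}, [/\ M \subset G, matching M &
    forall a, #|[set b | (a, b) \in G]| = k.+1 -> a \in fst @: M].
Proof.
move=> degB;
  have [|M [MG mM cov]] := @hall _ _ G [set a | #|[set b | (a, b) \in G]| == k.+1].
  move=> S SX; rewrite -(@leq_pmul2r k.+1) //.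
  have <- : #|[set p in G | p.1 \in S]| = #|S| * k.+1.
    rewrite card_edges (eq_bigr (fun=> k.+1)) ?sum_nat_const //.
    by move=> a /(subsetP SX); rewrite inE => /eqP.
  apply: (@leq_trans #|[set p in swap @: G | p.1 \in nbr G S]|).
    rewrite -(card_imset [set p in G | p.1 \in S] (can_inj (@swapK A B))).
    apply/subset_leq_card/subsetP=> _ /imsetP[[a b] + ->].
    rewrite !inE mem_swap /= => /andP[abG aS]; rewrite abG.
    by apply/exists_inP; exists a.
  rewrite card_edges -sum_nat_const leq_sum // => b _.
  by apply: leq_trans (degB b); apply/subset_leq_card/subsetP=> a; rewrite !inE mem_swap.
exists M; split=> // a dega; apply: (subsetP cov); rewrite inE; exact/eqP.
Qed.

(** Induction on [k]: matchings covering the vertices of full degree on either side are merged into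
    one covering both kinds. It serves as the last colour class, and its removal lowers the maximum
    degree. *)
Lemma konig_edge_coloring (A B : finType) (k : nat) (G : {set A * B}) :
  (forall a, #|[set b | (a, b) \in G]| <= k) ->
  (forall b, #|[set a | (a, b) \in G]| <= k) ->
  exists c : A * B -> nat, (forall p, p \in G -> c p < k) /\
    forall i, matching [set p in G | c p == i].
Proof.
elim: k G => [|k IH] G degA degB.
  exists (fun=> 0); have G0 a b : (a, b) \in G = false.
    apply/negP=> abG; have := degA a; rewrite leqn0 cards_eq0 => /eqP/setP/(_ b).
    by rewrite !inE abG.
  split=> [[a b]|i]; first by rewrite G0.
  by split=> -[a b] q; rewrite !inE G0.
have [M1 [M1G m1 cov1]] := matching_heavy degB.
have [|M2 [M2G m2 cov2]] := @matching_heavy _ _ (swap @: G) k.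
  by move=> a; apply: leq_trans (degA a); apply/subset_leq_card/subsetP=> b;
    rewrite !inE mem_swap.
have {M2G} M2G : swap @: M2 \subset G by rewrite -(swap_swap G) imsetS.
have [M [MM mM covA covB]] := mendelsohn_dulmage m1 (matching_swap m2).
have MG : M \subset G by apply: subset_trans MM _; rewrite subUset M1G.
have [||c [ck cm]] := IH (G :\: M).
- move=> a; have := degA a; rewrite leq_eqVlt => /orP[/eqP/[dup] dega /cov1|].
    move/(subsetP covA)=> /imsetP[[a' b] abM /= eqa]; rewrite -ltnS -dega.
    apply/proper_card/properP; split; last by exists b;
      rewrite !inE eqa ?abM ?(subsetP MG).
    by apply/subsetP=> b'; rewrite !inE => /andP[].
  rewrite ltnS; apply: leq_trans; apply/subset_leq_card/subsetP=> b'.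
  by rewrite !inE => /andP[].
- move=> b; have := degB b; rewrite leq_eqVlt => /orP[/eqP degb|].
    have /cov2/imsetP[[b' a'] abM2 /= eqb] : #|[set a | (b, a) \in swap @: G]| = k.+1.
      by rewrite -degb; apply: eq_card => a; rewrite !inE mem_swap.
    have: b \in snd @: (swap @: M2) by apply/imsetP; exists (a', b'); rewrite ?mem_swap.
    move/(subsetP covB)=> /imsetP[[a b''] abM /= {}eqb]; rewrite -ltnS -degb.
    apply/proper_card/properP; split; last by exists a;
      rewrite !inE eqb ?abM ?(subsetP MG).
    by apply/subsetP=> a2; rewrite !inE => /andP[].
  rewrite ltnS; apply: leq_trans; apply/subset_leq_card/subsetP=> a'.
  by rewrite !inE => /andP[].
exists (fun p => if p \in M then k else c p); split=> [p pG|i].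
  by case: ifPn => // pM; rewrite ltnS ltnW // ck // !inE pM.
have [->|ik] := eqVneq i k.
  apply: matching_sub mM; apply/subsetP=> p; rewrite inE => /andP[pG].
  case: ifPn => // pM /eqP cpk; have := ck p; rewrite !inE pM pG cpk ltnn.
  by move/(_ isT).
apply: matching_sub (cm i); apply/subsetP=> p; rewrite !inE => /andP[->].
by case: ifPn => //; rewrite eq_sym (negPf ik).
Qed.

(* Hall's theorem applied to [V] together with [d k] demand slots for each [k],
   to be matched into [A] and a second copy of [V]: a vertex of [V] may be
   matched to its own copy, which then cannot serve a slot. *)
Lemma matching_demands (A V K : finType) (G : {set A * V}) (f : V -> K) (d : K -> nat) :
  (forall X : {set A},
     \sum_k (d k - #|[set v in nbr G (~: X) | f v == k]|) <= #|X|) ->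
  exists M : {set A * V}, [/\ M \subset G, matching M &
    forall k, d k <= #|[set v in snd @: M | f v == k]|].
Proof.
move=> hd.
pose D := (V + {k : K & 'I_(d k)})%type.
pose H : {set D * (A + V)} := [set p | match p with
  | (inl v, inl a) => (a, v) \in G | (inl v, inr w) => v == w
  | (inr s, inr v) => f v == tag s | (inr _, inl _) => false end].
have [S _|M [/subsetP MH [m1 m2] covM]] := @hall _ _ H setT.
  pose I := [set v | inl v \in S]; pose J := [set s | inr s \in S].
  pose X := [set a | [exists v in I, (a, v) \in G]].
  pose KJ := [set tag s | s in J].
  have cardS : #|S| <= #|I| + #|J|.
    apply: (@leq_trans #|inl @: I :|: inr @: J|).
      apply/subset_leq_card/subsetP=> -[v|s] sS; rewrite inE; apply/orP; [left|right].
        by rewrite mem_imset ?inE //; apply: inl_inj.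
      by rewrite mem_imset ?inE //; apply: inr_inj.
    by apply: leq_trans (leq_card_setU _ _) _; apply: leq_add; apply: leq_imset_card.
  (* The neighbours of [S] include [X] in [A] and, in the second copy of [V], both [I] and the whole
     fibres of [f] over the symbols [KJ] of the slots in [S]. *)
  have cardN : #|X| + (#|I| + #|f @^-1: KJ :\: I|) <= #|nbr H S|.
    have <- : #|inl @: X :|: inr @: (I :|: (f @^-1: KJ)) : {set A + V}|
        = #|X| + (#|I| + #|f @^-1: KJ :\: I|).
      rewrite cardsU (_ : _ :&: _ = set0) ?cards0 ?subn0.
        rewrite !card_imset; [|exact: inr_inj|exact: inl_inj].
        rewrite cardsU cardsD [I :&: _]setIC.
        by have := subset_leq_card (subsetIl (f @^-1: KJ) I); lia.
      by apply/setP=> c; rewrite !inE; apply/negP=> /andP[/imsetP[? _ ->] /imsetP[]].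
    apply/subset_leq_card/subsetP=> c; rewrite inE => /orP[]/imsetP[z + ->].
      rewrite inE => /exists_inP[v vI av]; apply/nbrP; exists (inl v); rewrite ?inE //.
      by rewrite inE in vI.
    rewrite !inE => /orP[zS|/imsetP[u uJ fz]].
      by apply/exists_inP; exists (inl z); rewrite ?inE.
    by rewrite inE in uJ; apply/exists_inP; exists (inr u); rewrite ?inE // fz.
  apply: leq_trans cardS (leq_trans _ cardN).
  rewrite addnCA leq_add2l.
  have cardJ : #|J| <= \sum_(k in KJ) d k.
    rewrite -sum1_card (partition_big tag [in KJ]) /= => [|u uJ]; last exact: imset_f.
    apply: leq_sum => k _; rewrite sum1_card.
    apply: (@leq_trans #|[set Tagged (fun k => 'I_(d k)) j | j : 'I_(d k)]|); last first.
      by rewrite -[leqRHS]card_ord; apply: leq_imset_card.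
    apply/subset_leq_card/subsetP=> -[k' j] /andP[_ /eqP /= <-].
    exact: imset_f.
  apply: leq_trans cardJ _.
  have -> : #|f @^-1: KJ :\: I| = \sum_(k in KJ) #|[set v in ~: I | f v == k]|.
    rewrite -sum1_card (partition_big f [in KJ]) /= => [|v];
      last by rewrite !inE => /andP[].
    apply: eq_bigr => k kKJ; rewrite -sum1_card; apply: eq_bigl => v; rewrite !inE.
    by case: eqP => [->|_]; rewrite ?kKJ ?andbT ?andbF.
  (* By the choice of [X], no vertex of [I] has a neighbour outside [X]. Hence [nbr G (~: X)] lies
     in [~: I], and each summand is at least [d k]. *)
  apply: (@leq_trans (\sum_(k in KJ) ((d k - #|[set v in nbr G (~: X) | f v == k]|)
     + #|[set v in ~: I | f v == k]|))).
    apply: leq_sum => k _; rewrite addnC -leq_subLR leq_sub2l //.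
    apply/subset_leq_card/subsetP=> v; rewrite !inE => /andP[/exists_inP[a aX av] ->].
    rewrite andbT; apply: contraTN aX => vS.
    by rewrite !inE negbK; apply/exists_inP; exists v; rewrite ?inE.
  rewrite big_split leq_add2r /=; apply: leq_trans (hd X).
  by rewrite [leqRHS](bigID [in KJ]) leq_addr.
exists [set p | (inl p.2, inl p.1) \in M]; split.
- by apply/subsetP=> -[a v]; rewrite inE => /MH; rewrite inE.
- split=> -[a v] [a' v']; rewrite !inE /= => h h' e.
    by have [-> ->] : (inl v, inl a) = (inl v', inl a' : A + V) :> D * (A + V);
      first apply: m2; rewrite //= e.
  by have [-> ->] : (inl v, inl a) = (inl v', inl a' : A + V) :> D * (A + V);
    first apply: m1; rewrite //= e.
move=> k; have slot (j : 'I_(d k)) : exists v, (inr (Tagged (fun k =>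
  'I_(d k)) j), inr v) \in M.
  have /imsetP[[u [a|v]] uM /= eu] := subsetP covM (inr (Tagged (fun k =>
    'I_(d k)) j)) (in_setT _).
    by have := MH _ uM; rewrite -eu inE.
  by exists v; rewrite eu.
have [g gM] := fin_all_exists slot.
rewrite -[d k]card_ord -[leqLHS](@card_imset _ _ g); last first.
  move=> j j' eqg; have := m2 _ _ (gM j) (gM j'); rewrite eqg => /(_ erefl) [] /eqP.
  by rewrite eq_Tagged => /eqP.
apply/subset_leq_card/subsetP=> _ /imsetP[j _ ->].
have := MH _ (gM j); rewrite !inE /= => ->; rewrite andbT.
(* The vertex [g j] must be covered too; its own copy is taken by slot [j], so its partner lies in
   [A]. *)
have /imsetP[[u [a|v]] uM /= eu] := subsetP covM (inl (g j)) (in_setT _).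
  by apply/imsetP; exists (a, g j); rewrite // inE /= eu.
have := MH _ uM; rewrite -eu inE => /eqP eqv.
by have := m2 _ _ uM (gM j); rewrite -eu eqv => /(_ erefl) [].
Qed.

(** * Ryser's theorem on extending latin rectangles *)

Section Rectangles.
Variable n : nat.
Implicit Types (P Q : parray n) (i j k : 'I_n) (c : cell n).

Lemma card_ord_lt (s : nat) : s <= n -> #|[set j : 'I_n | j < s]| = s.
Proof.
move=> sn; have widen_inj : injective (widen_ord sn).
  by move=> i j /(congr1 val) /= /val_inj.
rewrite -[RHS]card_ord -[RHS](card_imset _ widen_inj); apply: eq_card => j.
rewrite inE; apply/idP/imsetP => [js|[i _ ->] //=].
by exists (Ordinal js) => //; apply: val_inj.
Qed.

Lemma card_ord_ge (s : nat) : #|[set j : 'I_n | s <= j]| = n - s.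
Proof.
have [sn|ns] := leqP s n.
  have := cardsC [set j : 'I_n | j < s]; rewrite card_ord_lt // card_ord.
  rewrite (_ : ~: _ = [set j : 'I_n | s <= j]) => [|]; first by lia.
  by apply/setP=> j; rewrite !inE -leqNgt.
rewrite (eqP (ltnW ns : n - s == 0)); apply/eqP; rewrite cards_eq0.
by apply/eqP/setP=> j; have := ltn_ord j; rewrite !inE; lia.
Qed.

Lemma missing_rowPn P k i : reflect (exists j, P i j = Some k) (~~ missing_row P k i).
Proof.
rewrite negb_forall; apply: (iffP existsP) => -[j]; first by move/negPn/eqP; exists j.
by exists j; apply/negPn/eqP.
Qed.

Lemma missing_colPn P k j : reflect (exists i, P i j = Some k) (~~ missing_col P k j).
Proof.
rewrite negb_forall; apply: (iffP existsP) => -[i]; first by move/negPn/eqP; exists i.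
by exists i; apply/negPn/eqP.
Qed.

Lemma filledP P i j : reflect (exists k, P i j = Some k) ((i, j) \in filled P).
Proof.
by rewrite inE /=; case: (P i j) => [k|]; constructor; [exists k | case].
Qed.

Lemma card_missing_row P i : partial_latin_square P ->
  #|[set k | missing_row P k i]| + #|[set j | (i, j) \in filled P]| = n.
Proof.
move=> [Prow _].
rewrite -[RHS]card_ord -(cardsC [set k | missing_row P k i]); congr (_ + _).
rewrite -(card_in_imset (f := P i)); last first.
  by move=> j j'; rewrite !inE /=; case E: (P i j) => [k|] // _ _ /esym /(Prow _ _ _ _ E).
rewrite -(card_imset (~: _) (@Some_inj _)); apply: eq_card => o.
apply/imsetP/imsetP => [[j + ->]|[k + ->]].
  rewrite inE => /filledP[k Pij]; exists k; rewrite // !inE.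
  by apply/missing_rowPn; exists j.
rewrite !inE => /missing_rowPn[j Pij]; exists j; rewrite // inE.
by apply/filledP; exists k.
Qed.

(** Each occurrence of [k] uses up one row and one column, so both counts are [n] minus the number
    of occurrences. *)
Lemma card_missing_col P k : partial_latin_square P ->
  #|[set j | missing_col P k j]| = #|[set i | missing_row P k i]|.
Proof.
move=> [Prow Pcol]; apply: (@addIn #|[set c : cell n | P c.1 c.2 == Some k]|).
transitivity n.
  rewrite -[RHS]card_ord -(cardsC [set j | missing_col P k j]); congr (_ + _).
  rewrite -(card_in_imset (f := snd)).
    apply: eq_card => j; rewrite !inE; apply/imsetP/missing_colPn => [[[i j']]|[i Pij]].
      by rewrite inE /= => /eqP Pij ->; exists i.
    by exists (i, j); rewrite // inE Pij.
  by move=> [i j] [i' j']; rewrite !inE /= => /eqP h /eqP h' e; rewrite -e in h' *;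
    rewrite (Pcol _ _ _ _ h h').
rewrite -[LHS]card_ord -(cardsC [set i | missing_row P k i]); congr (_ + _).
rewrite -(card_in_imset (f := fst)).
  apply: eq_card => i; rewrite !inE; apply/missing_rowPn/imsetP => [[j Pij]|[[i' j]]].
    by exists (i, j); rewrite // inE Pij.
  by rewrite inE /= => /eqP Pij ->; exists j.
by move=> [i j] [i' j']; rewrite !inE /= => /eqP h /eqP h' e; rewrite -e in h' *;
  rewrite (Prow _ _ _ _ h h').
Qed.

(** Join each of the first [r] rows to the symbols it misses. Rows have degree [n - s] and symbols
    at most that, so the edges can be coloured with [n - s] colours; the edges of colour [c] fill
    column [s + c]. *)
Lemma extend_columns (r s : nat) P :
  s <= n -> partial_latin_square P -> filled P = upper_left n r s ->
  (forall k, #|[set i : 'I_n | (i < r) && missing_row P k i]| <= n - s) ->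
  exists Q, [/\ partial_latin_square Q, filled Q = upper_left n r n &
    forall i j k, P i j = Some k -> Q i j = Some k].
Proof.
move=> sn hP fP hm; have [Prow Pcol] := hP.
pose G := [set p : 'I_n * 'I_n | (p.1 < r) && missing_row P p.2 p.1].
have degG i : i < r -> #|[set k | (i, k) \in G]| = n - s.
  move=> ir; have := card_missing_row i hP.
  have -> : [set j | (i, j) \in filled P] = [set j : 'I_n | j < s].
    by apply/setP=> j; rewrite inE fP !inE ir.
  rewrite card_ord_lt // (_ : [set k | missing_row P k i] = [set k | (i, k) \in G]);
    first by lia.
  by apply/setP=> k; rewrite !inE /= ir.
have [||c [clt cm]] := @konig_edge_coloring _ _ (n - s) G.
- move=> i; have [/degG->//|ri] := boolP (i < r).
  by rewrite (_ : [set k | _] = set0) ?cards0 //; apply/setP=> k;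
    rewrite !inE /= (negPf ri).
- by move=> k;
  rewrite (_ : [set a | _] = [set i : 'I_n | (i < r) && missing_row P k i]) ?hm //;
    apply/setP=> i; rewrite !inE.
pose Q : parray n := (\matrix_(i, j) if P i j is Some k then Some k else
  [pick k | ((i, k) \in G) && (c (i, k) + s == j)%N])%R.
have QP i j k : P i j = Some k -> Q i j = Some k by rewrite mxE => ->.
have QE i j k : Q i j = Some k ->
    P i j = Some k \/ [/\ (i, k) \in G, c (i, k) + s = j & P i j = None].
  rewrite mxE; case: (P i j) => [k'|]; first by left.
  by case: pickP => // k' /andP[kG /eqP ck] [<-]; right.
have miss i j k : (i, k) \in G -> P i j <> Some k.
  by rewrite inE => /andP[_ /forallP/(_ j)/eqP].
have colP i j k : P i j = Some k -> j < s.
  by move=> h; have: (i, j) \in filled P; [apply/filledP;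
    exists k | rewrite fP !inE => /andP[]].
exists Q; split=> //.
- split=> [i j j' k|i i' j k] /QE h /QE h'.
    case: h h' => [h|[h1 h2 h3]] [h'|[h1' h2' h3']].
    + exact: Prow h h'.
    + by case: (miss _ _ _ h1' h).
    + by case: (miss _ _ _ h1 h').
    + by apply/val_inj; rewrite /= -h2 -h2'.
  case: h h' => [h|[h1 h2 h3]] [h'|[h1' h2' h3']].
  + exact: Pcol h h'.
  + by have := colP _ _ _ h; rewrite -h2'; lia.
  + by have := colP _ _ _ h'; rewrite -h2; lia.
  + have [_ m2] := cm (c (i, k)).
    apply: (congr1 fst (m2 (i, k) (i', k) _ _ erefl)); rewrite inE ?h1 ?h1' ?eqxx //.
    by apply/andP; split=> //; apply/eqP; lia.
- apply/setP=> -[i j]; apply/filledP/idP => [[k /QE[h|[h _ _]]]|].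
  + have: (i, j) \in filled P by apply/filledP; exists k.
    by rewrite fP !inE /= ltn_ord andbT => /andP[].
  + by rewrite !inE /= ltn_ord andbT; rewrite inE in h; case/andP: h.
  rewrite inE /= => /andP[ir _].
  case Pij: (P i j) => [k|]; first by exists k; apply: QP.
  have sj : s <= j.
    rewrite leqNgt; apply/negP=> js; have: (i, j) \in filled P by rewrite fP !inE ir.
    by rewrite inE Pij.
  have jn := ltn_ord j.
  (* [h] sends a symbol missing from row [i] to the column of its colour. On these symbols the
     default [j] is never taken, since the colour is below [n - s]. Being injective from [n - s]
     symbols into [n - s] columns, [h] reaches column [j]. *)
  pose h k : 'I_n := insubd j (c (i, k) + s).
  have hE k : (i, k) \in G -> h k = c (i, k) + s :> nat.
    by move=> kG; rewrite val_insubd ifT //; have := clt _ kG; lia.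
  have: j \in h @: [set k | (i, k) \in G].
    suff -> : h @: [set k | (i, k) \in G] = [set j : 'I_n | s <= j] by rewrite inE.
    apply/eqP; rewrite eqEcard; apply/andP; split.
      by apply/subsetP=> _ /imsetP[k + ->]; rewrite !inE => kG;
        rewrite hE ?inE // leq_addl.
    rewrite card_ord_ge card_in_imset ?degG // => k k'; rewrite in_set => kG.
    rewrite in_set => kG' /(congr1 val) /=; rewrite !hE // => eqc.
    have [m1 _] := cm (c (i, k)).
    apply: (congr1 snd (m1 (i, k) (i, k') _ _ erefl)); rewrite inE ?kG ?kG' ?eqxx //.
    by apply/eqP/(@addIn s).
  case/imsetP=> k; rewrite inE => kG /(congr1 val) /=; rewrite hE // => eqj.
  rewrite mxE Pij; case: pickP => [k' _|/(_ k)]; first by exists k'.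
  by rewrite kG eqj eqxx.
Qed.

Lemma partial_latin_square_tr P : partial_latin_square P -> partial_latin_square (P^T)%R.
Proof.
move=> [Prow Pcol]; split=> [i j j' k|i i' j k]; rewrite !mxE; first exact: Pcol.
exact: Prow.
Qed.

Lemma missing_row_tr P k i : missing_row (P^T)%R k i = missing_col P k i.
Proof. by apply: eq_forallb => j; rewrite mxE. Qed.

Lemma completable_full P : partial_latin_square P -> filled P = setT -> completable P.
Proof.
move=> [Prow Pcol] fP; have full i j : exists k, P i j = Some k.
  by apply/filledP; rewrite fP inE.
(* The default [i] is never taken, as every cell is filled. *)
pose L := (\matrix_(i, j) odflt i (P i j))%R.
have PL i j : P i j = Some (L i j) by have [k Pij] := full i j; rewrite mxE Pij.
exists L => [|i j k]; last by rewrite PL => -[].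
split=> [i j j'|j i i'] eqL; first by apply: Prow (PL i j) _; rewrite eqL.
by apply: Pcol (PL i j) _; rewrite eqL.
Qed.

Lemma completable_tr P : completable (P^T)%R -> completable P.
Proof.
case=> L [Lrow Lcol] PL; exists (L^T)%R; last by move=> i j k Pij;
  rewrite mxE (PL j i k) ?mxE.
by split=> [i j j'|j i i']; rewrite !mxE; [apply: Lcol | apply: Lrow].
Qed.

Lemma completable_sub P Q : (forall i j k, P i j = Some k -> Q i j = Some k) ->
  completable Q -> completable P.
Proof. by move=> PQ [L hL QL]; exists L => // i j k /PQ/QL. Qed.

(** Columns are extended twice: first to an [r] by [n] rectangle, then, after transposing, to the
    full square. *)
Lemma ryser (r s : nat) P :
  r <= n -> s <= n -> partial_latin_square P -> filled P = upper_left n r s ->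
  (forall k, #|[set i : 'I_n | (i < r) && missing_row P k i]| <= n - s) ->
  completable P.
Proof.
move=> rn sn hP fP hm; have [Q [hQ fQ PQ]] := extend_columns sn hP fP hm.
apply: completable_sub PQ _; apply: completable_tr.
have fQt : filled (Q^T)%R = upper_left n n r.
  apply/setP=> -[i j]; have := congr1 (fun A : {set cell n} => (j, i) \in A) fQ.
  by rewrite !inE mxE /= !ltn_ord /= andbT => ->.
have [|R [hR fR QR]] := extend_columns rn (partial_latin_square_tr hQ) fQt.
  move=> k; under eq_finset do rewrite ltn_ord missing_row_tr.
  (* The columns of [Q] missing [k] are as many as the rows missing [k], and these are among the
     last [n - r]: the first [r] rows are full and contain every symbol. *)
  rewrite card_missing_col // -card_ord_ge; apply/subset_leq_card/subsetP=> i.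
  rewrite !inE => mk; rewrite leqNgt; apply: contraTN mk => ir.
  have := card_missing_row i hQ.
  have -> : [set j | (i, j) \in filled Q] = setT.
    by apply/setP=> j; rewrite inE fQ !inE ir ltn_ord.
  rewrite cardsT card_ord => /(canRL (addnK _)); rewrite subnn => /cards0_eq/setP/(_ k).
  by rewrite !inE => ->.
apply: completable_sub QR _; apply: completable_full hR _.
by rewrite fR; apply/setP=> c; rewrite !inE !ltn_ord.
Qed.

End Rectangles.

(** * Necessity of Hall's Condition: in a completion, the cells of [T] holding [k] form an
    independent set for [k], and these sets partition [T] *)

Lemma completable_hall n (P : parray n) :
  completable P -> hall_condition P.
Proof.
case=> L [Lrow Lcol] PL T; rewrite /hall_inequality.
rewrite -sum1_card (partition_big (fun c : cell n => L c.1 c.2) xpredT) //=.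
apply: leq_sum => k _; rewrite sum1_card.
rewrite (_ : #|_| = #|[set c in T | L c.1 c.2 == k]|); last by rewrite cardsE.
apply: (leq_bigmax_cond (F := fun S : {set cell n} => #|S|)).
apply/andP; split; first by apply/subsetP=> c; rewrite inE => /andP[].
apply/andP; split.
  apply/forall_inP=> -[i j]; rewrite inE => /andP[_ /eqP /= eqL].
  apply/forall_inP=> -[i' j']; rewrite inE => /andP[_ /eqP /= eqL'].
  apply/implyP; rewrite xpair_eqE negb_and.
  case: (eqVneq i i') => [eqi|ni] /=.
    by rewrite -eqi in eqL' *; rewrite (Lrow i j j') ?eqxx // eqL.
  move=> _; apply: contraNneq ni => eqj.
  by rewrite -eqj in eqL'; apply/eqP/(Lcol j); rewrite eqL.
apply/forall_inP=> -[i j]; rewrite inE => /andP[_ /eqP /= eqL].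
rewrite /supports /=; case Pij: (P i j) => [k'|].
  by rewrite -(PL _ _ _ Pij) eqL eqxx.
rewrite eqxx /=; apply/andP; split; apply/forallP.
  move=> j'; apply/negP=> /eqP Pij';
    have /(Lrow i) eqj : L i j' = L i j by rewrite eqL (PL _ _ _ Pij').
  by rewrite eqj Pij in Pij'.
move=> i'; apply/negP=> /eqP Pij';
  have /(Lcol j) eqi : L i' j = L i j by rewrite eqL (PL _ _ _ Pij').
by rewrite eqi Pij in Pij'.
Qed.

(** * Sufficiency of Hall's Condition *)

Lemma alpha_leqP n (P : parray n) (k : 'I_n) (T : {set cell n}) m :
  (forall S : {set cell n},
     S \subset T -> independent S -> {in S, forall c, supports P k c} -> #|S| <= m) ->
  alpha P k T <= m.
Proof. by move=> h; apply/bigmax_leqP=> S /and3P[ST indS /forall_inP supS]; apply: h. Qed.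

Lemma independent_inj n (S : {set cell n}) :
  independent S -> {in S &, injective fst} /\ {in S &, injective snd}.
Proof.
move=> /forall_inP indS; split=> c d cS dS eqcd; apply/eqP; apply: contraT => ncd;
  by have /forall_inP/(_ d dS)/implyP/(_ ncd)/andP[] := indS c cS; rewrite eqcd eqxx.
Qed.

Section Filling.
Variables (n r s : nat) (P : parray n) (E : {set cell n}).
Hypotheses (rn : r <= n) (sn : s <= n) (hP : partial_latin_square P).
Hypotheses (hE : E \subset upper_left n r s) (fP : filled P = upper_left n r s :\: E).
Hypothesis hcol : forall j : 'I_n, #|[set c in E | c.2 == j]| <= 1.
Implicit Types (S T X : {set cell n}) (i j k : 'I_n) (c : cell n).

(** A matching places symbols in cells of [E]: injectivity on the left means one symbol per cell,
    injectivity on the right means no symbol twice in a row. *)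
Let filling_graph : {set cell n * ('I_n * 'I_n)} :=
  [set p | [&& p.1 \in E, supports P p.2.2 p.1 & p.1.1 == p.2.1]].

Let demand k := #|[set i : 'I_n | (i < r) && missing_row P k i]| - (n - s).

(** Cells of an independent set lie in distinct rows, so they yield distinct (row, [k]) pairs. *)
Lemma alpha_nbr k T : T \subset E ->
  alpha P k T <= #|[set v in nbr filling_graph T | v.2 == k]|.
Proof.
move=> /subsetP TE; apply: alpha_leqP => S /subsetP ST /independent_inj[inj1 _] supS.
rewrite -(card_in_imset (f := fun c : cell n => (c.1, k)));
  last by move=> c d cS dS [/inj1]; apply.
apply/subset_leq_card/subsetP=> _ /imsetP[c cS ->]; rewrite !inE eqxx andbT.
by apply/exists_inP; exists c; rewrite ?ST // !inE /= TE ?ST // supS // eqxx.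
Qed.

(** An independent set for [k] avoiding [E :&: X] has at most [n - s] cells right of the rectangle.
    Any other cell lies in one of the [n - m] rows outside the rows of the rectangle missing [k], or
    it is a cell of [E] outside [X] and its row is counted by [N]. This bound and the trivial bound
    [n] together give the claim. *)
Lemma alpha_demand k X :
  alpha P k (~: (E :&: X)) + (demand k - #|[set v in nbr filling_graph (~: X) | v.2 ==
    k]|) <= n.
Proof.
set N := [set v in _ | _]; pose m := #|[set i : 'I_n | (i < r) && missing_row P k i]|.
suff: alpha P k (~: (E :&: X)) <= minn n ((n - s) + ((n - m) + #|N|)).
  by have : m <= n; [rewrite -[leqRHS]card_ord max_card | rewrite /demand -/m; lia].
apply: alpha_leqP => S /subsetP ST /independent_inj[inj1 inj2] supS; rewrite leq_min.
apply/andP; split.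
  by rewrite -(card_in_imset inj1) -[leqRHS]card_ord max_card.
have -> : n - m = #|~: [set i : 'I_n | (i < r) && missing_row P k i]|.
  by have := cardsC [set i : 'I_n | (i < r) && missing_row P k i]; rewrite card_ord -/m;
    lia.
rewrite -card_ord_ge -(cardsID [set c : cell n | s <= c.2] S) leq_add //.
  rewrite -(card_in_imset (f := snd)); last by move=> c d /setIP[cS _] /setIP[dS _];
    apply: inj2.
  by apply/subset_leq_card/subsetP=> _ /imsetP[c + ->]; rewrite !inE => /andP[].
rewrite -[leqLHS](card_in_imset (f := fst)); last by move=> c d;
  rewrite !inE => /andP[_ cS] /andP[_ dS]; apply: inj1.
apply: (@leq_trans #|~: [set i : 'I_n | (i < r) && missing_row P k i] :|: fst @: N|);
  last first.
  by apply: leq_trans (leq_card_setU _ _) _; rewrite leq_add2l leq_imset_card.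
apply/subset_leq_card/subsetP=> _ /imsetP[[i j] + ->];
  rewrite !inE -ltnNge /= => /andP[js cS].
case: (boolP (_ && _)) => //= /andP[ir mk]; apply/imsetP; exists (i, k) => //.
have := supS _ cS;
  rewrite /supports /= (negPf (forallP mk j)) /= => /and3P[/eqP Pij _ mkc].
have cE : (i, j) \in E.
  have: (i, j) \notin filled P by rewrite inE /= Pij.
  by rewrite fP !inE ir js !andbT negbK.
rewrite !inE eqxx andbT; apply/exists_inP; exists (i, j).
  by have := ST _ cS; rewrite !inE cE.
by rewrite !inE /= cE eqxx andbT /supports /= Pij mk mkc.
Qed.

Lemma card_fibers X :
  \sum_k #|[set v in nbr filling_graph X | v.2 == k]| = #|nbr filling_graph X|.
Proof.
rewrite -[RHS]sum1_card (partition_big snd xpredT) //=.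
by apply: eq_bigr => k _; rewrite -sum1_card; apply: eq_bigl => v; rewrite inE.
Qed.

Hypothesis hallP : hall_condition P.

Lemma filling : exists M : {set cell n * ('I_n * 'I_n)},
  [/\ M \subset filling_graph, matching M, E \subset fst @: M &
    forall k, demand k <= #|[set v in snd @: M | v.2 == k]|].
Proof.
have [S SE|M1 [M1G m1 cov1]] := @hall _ _ filling_graph E.
  apply: leq_trans (hallP S) _; rewrite -card_fibers leq_sum // => k _.
  exact: alpha_nbr.
(* Summing [alpha_demand] over [k] gives at most [n * n], the number of all cells. Hall's inequality
   for [~: (E :&: X)] takes up all but [#|E :&: X|] of it. *)
have [X|M2 [M2G m2 cov2]] := @matching_demands _ _ _ filling_graph snd demand.
  have: \sum_(k < n) (alpha P k (~: (E :&: X)) +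
      (demand k - #|[set v in nbr filling_graph (~: X) | v.2 == k]|)) <= \sum_(k < n) n.
    by apply: leq_sum => k _; apply: alpha_demand.
  rewrite big_split /= sum_nat_const card_ord => h.
  have := hallP (~: (E :&: X)); rewrite /hall_inequality => hT.
  have := cardsC (E :&: X); rewrite card_prod card_ord => hC.
  rewrite -(leq_add2l #|~: (E :&: X)|); apply: leq_trans (leq_add hT (leqnn _)) _.
  by apply: leq_trans h _; rewrite -hC addnC leq_add2l subset_leq_card ?subsetIr.
(* Covering [E] concerns left ends, taken from [M1]; the demands are monotone in the set of right
   ends, taken from [M2]. *)
have [M [MM mM covA covB]] := mendelsohn_dulmage m1 m2.
exists M; split=> //.
- by apply: subset_trans MM _; rewrite subUset M1G.
- exact: subset_trans cov1 covA.
move=> k; apply: leq_trans (cov2 k) _; apply/subset_leq_card/subsetP=> v.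
by rewrite !inE => /andP[/(subsetP covB)-> ->].
Qed.

Lemma hall_completable : completable P.
Proof.
have [M [/subsetP MG [m1 m2] /subsetP covE dem]] := filling.
have [Prow Pcol] := hP.
pose Q : parray n := (\matrix_(i, j) if P i j is Some k then Some k else
  [pick k | ((i, j), (i, k)) \in M])%R.
have QP i j k : P i j = Some k -> Q i j = Some k by rewrite mxE => ->.
have QE i j k : Q i j = Some k ->
    P i j = Some k \/ [/\ ((i, j), (i, k)) \in M, (i, j) \in E, missing_row P k i &
      missing_col P k j].
  rewrite mxE; case Pij: (P i j) => [k'|]; first by left.
  case: pickP => // k' kM [<-]; right; have := MG _ kM; rewrite inE /= /supports /= Pij.
  by case/and3P=> ijE /= /andP[]; split.
have EP i j : (i, j) \in E -> P i j = None.
  move=> ijE; apply/eqP; apply: contraTT ijE => Pij.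
  by have: (i, j) \in filled P; [rewrite inE | rewrite fP inE => /andP[]].
have QM i j k : ((i, j), (i, k)) \in M -> Q i j = Some k.
  move=> kM; have := MG _ kM; rewrite inE => /and3P[/= ijE _ _].
  rewrite mxE EP //; case: pickP => [k' k'M|/(_ k)]; last by rewrite kM.
  by have [->] := m1 _ _ kM k'M erefl.
have filledQ : filled Q = upper_left n r s.
  apply/setP=> -[i j]; apply/filledP/idP => [[k /QE[Pij|[_ /(subsetP hE)//]]]|ijR].
    have: (i, j) \in filled P by apply/filledP; exists k.
    by rewrite fP inE => /andP[].
  have [ijE|ijE] := boolP ((i, j) \in E).
    have /imsetP[[c [i' k]] pM /= eqc] := covE _ ijE.
    have := MG _ pM; rewrite !inE -eqc /= => /and3P[_ _ /eqP eqi].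
    by exists k; apply: QM; rewrite -eqc -eqi in pM.
  have: (i, j) \in filled P by rewrite fP inE ijE.
  by case/filledP=> k /QP; exists k.
have plsQ : partial_latin_square Q.
  split=> [i j j' k|i i' j k] /QE h /QE h'.
    case: h h' => [h|[hM hij hr hc]] [h'|[hM' hij' hr' hc']].
    + exact: Prow h h'.
    + by have := forallP hr' j; rewrite h eqxx.
    + by have := forallP hr j'; rewrite h' eqxx.
    + by have [] := m2 _ _ hM hM' erefl.
  case: h h' => [h|[hM hij hr hc]] [h'|[hM' hij' hr' hc']].
  + exact: Pcol h h'.
  + by have := forallP hc' i; rewrite h eqxx.
  + by have := forallP hc i'; rewrite h' eqxx.
  (* Two newly filled cells in one column both lie in [E], hence coincide. *)
  + have /card_le1_eqP/(_ (i, j) (i', j)) := hcol j.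
    by rewrite !inE hij hij' eqxx => /(_ isT isT) [].
apply: (completable_sub QP); apply: (ryser rn sn plsQ filledQ) => k.
(* [R] holds the rows of the rectangle missing [k] before the filling, and [fst @: W] those that
   receive [k]. The demand leaves [#|R| - #|W| <= n - s] rows still missing [k], which is Ryser's
   condition. *)
have := dem k; rewrite /demand; set W := [set v in _ | _]; set R := [set i | _ & _].
move=> dW.
have injW : {in W &, injective fst}.
  by move=> [i k1] [i' k2]; rewrite !inE /= => /andP[_ /eqP->] /andP[_ /eqP->] ->.
have WR : fst @: W \subset R.
  apply/subsetP=> _ /imsetP[[i k'] + ->];
    rewrite !inE => /andP[/imsetP[[[i1 j] v] pM /= eqv] /eqP eqk].
  have := MG _ pM; rewrite -eqv inE /= eqk => /and3P[ijE + /eqP eqi].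
  have := subsetP hE _ ijE; rewrite inE /= eqi => /andP[-> _].
  by rewrite /supports /= EP -?eqi //= => /andP[].
apply: (@leq_trans #|R :\: fst @: W|).
  apply/subset_leq_card/subsetP=> i; rewrite !inE => /andP[ir mk].
  rewrite ir /=; apply/andP; split.
    apply: contraL mk => /imsetP[[i' k'] + ->];
      rewrite !inE => /andP[/imsetP[[[i1 j] v] pM /= eqv] /eqP eqk].
    apply/missing_rowPn; exists j.
    have := MG _ pM; rewrite -eqv inE /= => /and3P[_ _ /eqP eqi].
    by apply: QM; rewrite -eqv eqi eqk in pM.
  by apply: contraTT mk => /missing_rowPn[j /QP Qij]; apply/missing_rowPn; exists j.
rewrite cardsDS // card_in_imset //; lia.
Qed.

End Filling.

Theorem theorem3 (n r s t : nat) (P : parray n) (E : {set cell n})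
    (hr : 1 <= r <= n) (hs : 1 <= s <= n)
    (hP : partial_latin_square P)
    (hE : E \subset upper_left n r s)
    (ht : #|E| = t)
    (hfilled : filled P = upper_left n r s :\: E)
    (hcol : forall j : 'I_n, #|[set c in E | c.2 == j]| <= 1) :
  completable P <-> hall_condition P.
Proof.
split; first exact: completable_hall.
case/andP: hr => _ rn; case/andP: hs => _ sn.
exact: hall_completable rn sn hP hE hfilled hcol.
Qed.
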